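(* The second variety of reductions $Y_2\subset G(2,\mathfrak{sl}_3)$ is the variety of abelian planes in $\mathfrak{sl}_3$, i.e. of two-dimensional subspaces $P\subset\mathfrak{sl}_3$ such that $[X,Y]=0$ for all $X,Y\in P$.
   Context: Let $M_3(\mathbf C)$ be the space of complex $3\times 3$ matrices, $I$ the identity matrix, $\mathfrak{sl}_3\subset M_3(\mathbf C)$ the traceless matrices, and $X_2\simeq\mathbb P^2\times\mathbb P^2\subset\mathbb P(M_3(\mathbf C))$ the Segre variety of rank one matrices. (The Jordan algebra $\mathcal J_3(\mathbb C)$ of $3\times3$ Hermitian matrices over the complexification $\mathbb C=\mathbf C\otimes_{\mathbf R}\mathbf C$ is identified with $M_3(\mathbf C)$, and its traceless part with $\mathfrak{sl}_3$.) A plane in $\mathbb P(M_3(\mathbf C))$ is simply $3$-secant to $X_2$ if it meets $X_2$ in exactly three points, each a simple contact. Projection from $[I]$, $X\mapsto X-\frac13\operatorname{trace}(X)I$, sends planes through $[I]$ to lines in $\mathbb P(\mathfrak{sl}_3)$. The variety of reductions $Y_2\subset G(2,\mathfrak{sl}_3)$ (Grassmannian of $2$-dimensional subspaces of $\mathfrak{sl}_3$, i.e. lines in $\mathbb P(\mathfrak{sl}_3)$) is the Zariski closure of the set of lines that are images of planes through $[I]$ simply $3$-secant to $X_2$. *)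

(* Defs.v *)
From HB Require Import structures.
From mathcomp Require Import all_boot all_order all_algebra.
From mathcomp Require Import classical_sets cardinality reals complex mpoly.

Set Implicit Arguments.
Unset Strict Implicit.
Unset Printing Implicit Defensive.

Import Order.TTheory GRing.Theory Num.Theory.

Local Open Scope classical_set_scope.
Local Open Scope ring_scope.

(* Linear subspaces of P(M_3(C)) are represented by vector subspaces of
   'M[C]_3 of one dimension more: a point is a line <[x]>%VS, a plane is a
   subspace of dimension 3, a line is a subspace of dimension 2.             *)

Section Reductions.
Variable R : realType.
Local Notation C := R[i].

Fact mxtrace_scalar_linear :
  linear (fun X : 'M[C]_3 => \tr X : C^o).
Proof. by move=> a X Y; rewrite linearP. Qed.

Definition trace_fun (X : 'M[C]_3) : C^o := \tr X.

HB.instance Definition _ := GRing.isLinear.Build C 'M[C]_3 C^o _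
  trace_fun mxtrace_scalar_linear.

Definition sl3 : {vspace 'M[C]_3} := lker (linfun trace_fun).

Lemma mem_sl3 (X : 'M[C]_3) : (X \in sl3) = (\tr X == 0).
Proof. by rewrite memv_ker lfunE. Qed.

Definition lie (X Y : 'M[C]_3) : 'M[C]_3 := X *m Y - Y *m X.

Definition G2sl3 : set {vspace 'M[C]_3} :=
  [set U | (U <= sl3)%VS /\ \dim U = 2%N].

Definition X2 : set {vspace 'M[C]_3} :=
  [set <[x]>%VS | x in [set x | \rank x = 1%N]].

(* Affine Zariski tangent space of the cone over X2 at x: X2 is cut out by the
   2 x 2 minors x i k * x j l - x i l * x j k, which generate its ideal; the
   left-hand side below is the differential of such a minor at x, applied
   to y.                                                                     *)
Definition X2_tangent (x : 'M[C]_3) : set 'M[C]_3 :=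
  [set y | forall i j k l : 'I_3,
     x i k * y j l + y i k * x j l - (x i l * y j k + y i l * x j k) = 0].

(* The scheme P(W) :&: X2 is reduced and isolated at its point <[x]>: its
   Zariski tangent space there, the quotient of (X2_tangent x) :&: W by
   <[x]>, vanishes.                                                          *)
Definition simple_contact (W : {vspace 'M[C]_3}) (x : 'M[C]_3) : Prop :=
  forall y, y \in W -> X2_tangent x y -> y \in <[x]>%VS.

Definition simply_3_secant (W : {vspace 'M[C]_3}) : Prop :=
  ([set L | X2 L /\ (L <= W)%VS] #= `I_3)%card /\
  (forall x, \rank x = 1%N -> x \in W -> simple_contact W x).

Definition projI (X : 'M[C]_3) : 'M[C]_3 := X - (3%:R^-1 * \tr X)%:M.

Fact projI_is_linear : linear projI.
Proof.
move=> a X Y; apply/matrixP=> i j; rewrite /projI linearP /= !mxE.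
by case: (i == j); rewrite ?mulr1n ?mulr0n ?subr0 // mulrBr mulrDr opprD
  [3%:R^-1 * (a * _)]mulrCA addrACA.
Qed.

HB.instance Definition _ := GRing.isLinear.Build C 'M[C]_3 'M[C]_3 _
  projI projI_is_linear.

(* Each such image is a 2-dimensional subspace of sl3: I spans the kernel of
   projI and lies in W.                                                      *)
Definition secant_reductions : set {vspace 'M[C]_3} :=
  [set (linfun projI @: W)%VS | W in
    [set W : {vspace 'M[C]_3} |
       [/\ \dim W = 3%N, 1%:M \in W & simply_3_secant W]]].

(* Pluecker vector of the plane with basis (u, v): the bivector u /\ v, as the
   alternating matrix of all u_i v_j - u_j v_i, where u and v are written in
   the canonical coordinates of M_3(C).  The linear embedding of the exterior
   square of M_3(C) into 9 x 9 matrices leaves the Zariski topology unchanged. *)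
Definition pluecker (u v : 'M[C]_3) : 'rV[C]_((3 * 3) * (3 * 3)) :=
  mxvec ((mxvec u)^T *m mxvec v - (mxvec v)^T *m mxvec u).

(* For homogeneous p, the condition does not depend on the basis (u, v). *)
Definition vanishes_at (p : {mpoly C[(3 * 3) * (3 * 3)]})
    (U : {vspace 'M[C]_3}) : Prop :=
  forall u v, basis_of U [:: u; v] -> p.@[fun k => pluecker u v 0 k] = 0.

Definition zariski_closed (Z : set {vspace 'M[C]_3}) : Prop :=
  exists F : set {mpoly C[(3 * 3) * (3 * 3)]},
    (forall p, F p -> exists d : nat, p \is d.-homog) /\
    Z = [set U | G2sl3 U /\ forall p, F p -> vanishes_at p U].

Definition Y2 : set {vspace 'M[C]_3} :=
  smallest zariski_closed secant_reductions.

Definition abelian_planes : set {vspace 'M[C]_3} :=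
  [set P | G2sl3 P /\ forall X Y, X \in P -> Y \in P -> lie X Y = 0].

End Reductions.

Arguments sl3 R : clear implicits.
Arguments G2sl3 R _ : clear implicits.
Arguments X2 R _ : clear implicits.
Arguments secant_reductions R _ : clear implicits.
Arguments Y2 R _ : clear implicits.
Arguments abelian_planes R _ : clear implicits.

(* Main.v *)
Require Import Defs.
From mathcomp Require Import all_boot all_order all_algebra.
From mathcomp Require Import classical_sets reals.
From mathcomp Require Import cardinality complex mpoly ring.

(* If a plane W through [I] meets X2 in exactly three points, these span W:
   otherwise they are collinear and X2 contains the whole line.  Then I is a sum
   of three rank one matrices spanning W, which is therefore conjugate to the
   algebra of diagonal matrices; so reductions are abelian.  Abelian planes form
   a closed set since [u, v] depends only on the bivector of u and v.

   Conversely, a commuting pair (u, v) is simultaneously triangular.  Each off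
   diagonal position of the pair is a vector of C^2, and so is each difference
   of diagonal entries; commutation says that certain determinants of these
   vectors vanish.  These equations let one move (u, v) along at most two
   successive lines of commuting pairs so as to reach simultaneously
   diagonalizable pairs, whose planes are reductions.  A polynomial vanishing at
   all but finitely many points of a line vanishes on the line. *)

Set Implicit Arguments.
Unset Strict Implicit.
Unset Printing Implicit Defensive.

Import Order.TTheory GRing.Theory Num.Theory.
Local Open Scope classical_set_scope.
Local Open Scope ring_scope.

(** * Determinants of vectors in the plane and deformation of commuting triangular pairs *)

Section PlaneVectors.
Variable F : fieldType.
Implicit Types (a b x y z : 'rV[F]_2).

Definition det2 a b : F := a 0 0 * b 0 1 - a 0 1 * b 0 0.

Lemma row2P a b : a 0 0 = b 0 0 -> a 0 1 = b 0 1 -> a = b.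
Proof.
move=> e0 e1; apply/rowP => i.
case: (unliftP ord0 i) => [j|] -> //.
by rewrite ord1 (_ : lift _ _ = 1) //; apply/val_inj.
Qed.

Lemma det2_eq0_colinear a b : a != 0 -> det2 a b = 0 -> exists p, b = p *: a.
Proof.
move=> a0 /eqP; rewrite subr_eq0 => /eqP ab.
have [a00|a00] := eqVneq (a 0 0) 0; last first.
  exists (b 0 0 / a 0 0); apply: row2P; rewrite !mxE; first by field.
  by apply: (mulfI a00); rewrite ab; field.
have a01 : a 0 1 != 0.
  by apply: contraNneq a0 => a01; apply/eqP/row2P; rewrite mxE.
exists (b 0 1 / a 0 1); apply: row2P; rewrite !mxE; last by field.
by apply: (mulfI a01); rewrite -ab; field.
Qed.

Lemma exists_nz_multiple x : exists2 e, e != 0 & exists p, x = p *: e.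
Proof.
have [->|x0] := eqVneq x 0; last by exists x => //; exists 1; rewrite scale1r.
exists (const_mx 1); last by exists 0; rewrite scale0r.
by apply/eqP => /rowP/(_ 0); rewrite !mxE; apply/eqP/oner_neq0.
Qed.

(* For a pair of lower triangular 3 x 3 matrices, a and b are the differences of
   consecutive diagonal entries and x, y, z the entries (2,1), (3,2), (3,1); the
   determinantal equations say that the two matrices commute, and the first
   premise covers the pairs diagonalized by one common unipotent matrix. *)
Lemma commuting_triangular_ind
    (G : 'rV[F]_2 -> 'rV[F]_2 -> 'rV[F]_2 -> 'rV[F]_2 -> 'rV[F]_2 -> Prop) :
  (forall a b p q r,
     G a b (p *: a) (q *: b) ((p * q) *: a + r *: (a + b))) ->
  (forall a b x y z a' b' y' z',
     (forall s, s != 0 ->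
        G (a + s *: a') (b + s *: b') x (y + s *: y') (z + s *: z')) ->
     G a b x y z) ->
  forall a b x y z, det2 a x = 0 -> det2 b y = 0 ->
    det2 z (a + b) = det2 x y -> G a b x y z.
Proof.
move=> Gdiag Gcurve a b x y z.
have vecE := (mxE, mulr0, mul0r, mulr1, mul1r, addr0, add0r, scale0r, scaler0).
(* The case [c + d = 0]. Moving [d] to [- c + s *: e] makes the sum [s *: e], so choosing [e] along
   [w - (p * q) *: c] turns the pair into one covered by [Gdiag]. *)
have opposite c d u v w : c != 0 -> c + d = 0 -> det2 c u = 0 ->
    det2 d v = 0 -> G c d u v w.
  move=> c0 cd /(det2_eq0_colinear c0)[p ->] dv.
  have -> : d = - c by apply/eqP; rewrite -addr_eq0 addrC cd.
  have [q ->] : exists q, v = q *: - c.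
    apply: det2_eq0_colinear; rewrite ?oppr_eq0 //.
    rewrite -[RHS]dv; congr det2.
    by apply/eqP; rewrite eq_sym -addr_eq0 addrC cd.
  have [e e0 [k wE]] := exists_nz_multiple (w - (p * q) *: c).
  apply: (Gcurve _ _ _ _ _ 0 e (q *: e) 0) => s s0.
  have -> : c + s *: 0 = c by rewrite !vecE.
  have -> : q *: - c + s *: (q *: e) = q *: (- c + s *: e).
    by apply: row2P; rewrite !mxE; ring.
  have -> : w + s *: 0 = (p * q) *: c + (k / s) *: (c + (- c + s *: e)).
    rewrite scaler0 addr0 addrA subrr add0r scalerA divfK // -wE.
    by rewrite addrC subrK.
  exact: Gdiag.
have [->|a0] := eqVneq a 0; have [->|b0] := eqVneq b 0.
(* Here [x] and [y] are multiples of a common nonzero [e]. Opening the differences to [s *: e] and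
   [- (s *: e)] leads to the case [opposite], which uses a second line. *)
- move=> _ _; rewrite addr0 /det2 !mxE !mulr0 subr0 => /esym xy.
  have [e e0 [p [q [-> ->]]]] : exists2 e, e != 0 &
      exists p q, x = p *: e /\ y = q *: e.
    have [x0|x0] := eqVneq x 0; last first.
      have [q ->] := det2_eq0_colinear x0 xy.
      by exists x => //; exists 1, q; rewrite scale1r.
    have [e e0 [q ->]] := exists_nz_multiple y.
    by exists e => //; exists 0, q; rewrite x0 scale0r.
  apply: (Gcurve _ _ _ _ _ e (- e) 0 0) => s s0; rewrite !add0r !scaler0 !addr0.
  apply: opposite.
  + by rewrite scaler_eq0 negb_or s0.
  + by rewrite scalerN subrr.
  + by rewrite /det2 !mxE; ring.
  + by rewrite /det2 !mxE; ring.
(* The equations give [z = r *: b + q *: x]. Opening [a] along the direction of [x] makes [x] a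
   multiple of [a]; [z] must follow by [s *: (r *: e)] to keep the coefficient [r] of [a + b]. The
   next case is symmetric. *)
- move=> _ /(det2_eq0_colinear b0)[q ->]; rewrite add0r => zb.
  have /(det2_eq0_colinear b0)[r /eqP] : det2 b (z - q *: x) = 0.
    move: zb; rewrite /det2 !mxE => /eqP; rewrite -subr_eq0 => /eqP zb.
    by apply/eqP; rewrite -oppr_eq0 -[X in _ == X]zb; apply/eqP; ring.
  rewrite subr_eq => /eqP ->.
  have [e e0 [k ->]] := exists_nz_multiple x.
  apply: (Gcurve _ _ _ _ _ e 0 0 (r *: e)) => s s0.
  rewrite !add0r !scaler0 !addr0.
  have -> : r *: b + q *: (k *: e) + s *: (r *: e) =
      (k / s * q) *: (s *: e) + r *: (s *: e + b).
    by apply: row2P; rewrite !mxE; field.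
  have -> : k *: e = (k / s) *: (s *: e) by rewrite scalerA divfK.
  exact: Gdiag.
- move=> /(det2_eq0_colinear a0)[p ->] _; rewrite addr0 => za.
  have /(det2_eq0_colinear a0)[r /eqP] : det2 a (z - (- p) *: y) = 0.
    move: za; rewrite /det2 !mxE => /eqP; rewrite -subr_eq0 => /eqP za.
    by apply/eqP; rewrite -oppr_eq0 -[X in _ == X]za; apply/eqP; ring.
  rewrite subr_eq => /eqP ->.
  have [e e0 [k ->]] := exists_nz_multiple y.
  apply: (Gcurve _ _ _ _ _ 0 e 0 (r *: e)) => s s0.
  rewrite !add0r !scaler0 !addr0.
  have -> : r *: a + (- p) *: (k *: e) + s *: (r *: e) =
      (p * (k / s)) *: a + (r - p * (k / s)) *: (a + s *: e).
    by apply: row2P; rewrite !mxE; field.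
  have -> : k *: e = (k / s) *: (s *: e) by rewrite scalerA divfK.
  exact: Gdiag.
move=> ax /[dup] bY /(det2_eq0_colinear b0)[q yE].
have [ab|ab] := eqVneq (a + b) 0; first by move=> _; apply: opposite.
have [p xE] := det2_eq0_colinear a0 ax; rewrite {}xE {}yE => zab.
have /(det2_eq0_colinear ab)[r /eqP] : det2 (a + b) (z - (p * q) *: a) = 0.
  move: zab; rewrite /det2 !mxE => /eqP; rewrite -subr_eq0 => /eqP zab.
  by apply/eqP; rewrite -oppr_eq0 -[X in _ == X]zab; apply/eqP; ring.
rewrite subr_eq [eqbRHS]addrC => /eqP ->; exact: Gdiag.
Qed.

End PlaneVectors.

(** * Rank one matrices and their 2 x 2 minors *)

Section RankOne.
Variables (F : fieldType) (m n : nat).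

Lemma rank1_minors (A : 'M[F]_(m, n)) (i j : 'I_m) (k l : 'I_n) :
  \rank A = 1%N -> A i k * A j l = A i l * A j k .
Proof.
move=> rA; move: (col_base A) (row_base A) (mulmx_base A); rewrite rA => c r <-.
by rewrite !mxE !big_ord1; ring.
Qed.

Lemma minors_rank1 (A : 'M[F]_(m, n)) : A != 0 ->
  (forall i j k l, A i k * A j l = A i l * A j k) -> \rank A = 1%N.
Proof.
move=> A0 minors; apply/eqP; rewrite eqn_leq lt0n mxrank_eq0 A0 andbT.
have [[i k] /= Aik] : exists ik, A ik.1 ik.2 != 0.
  apply/existsP; apply: contraR A0 => /existsPn A0.
  by apply/eqP/matrixP => i k; rewrite mxE; apply/eqP/negPn/(A0 (i, k)).
have -> : A = (A i k)^-1 *: (col k A *m row i A).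
  apply/matrixP => j l; rewrite !mxE big_ord1 !mxE.
  by apply: (mulfI Aik); rewrite minors; field.
apply: leq_trans (mxrank_scale _ _) _.
exact: leq_trans (mxrankM_maxl _ _) (rank_leq_col _).
Qed.

(* If three points of the line through [x] and [y] lie on X2 then the whole
   line does: the minors of [a x + b y] are quadratic forms in [(a, b)]. *)
Lemma rank1_pencil (x y : 'M[F]_(m, n)) a b s t :
  \rank x = 1%N -> \rank y = 1%N -> \rank (a *: x + b *: y)%R = 1%N ->
  a != 0 -> b != 0 -> s *: x + t *: y != 0 -> \rank (s *: x + t *: y)%R = 1%N.
Proof.
move=> rx ry rxy a0 b0 nz; apply: minors_rank1 => // i j k l.
have mx := rank1_minors i j k l rx; have my := rank1_minors i j k l ry.
have := rank1_minors i j k l rxy; rewrite !mxE => mxy.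
(* The polarized minor is the coefficient of [a * b] in the minor of [a *: x + b *: y]; the third
   point forces it to vanish. *)
have cross : x i k * y j l + y i k * x j l = x i l * y j k + y i l * x j k.
  apply: (mulfI (mulf_neq0 a0 b0)).
  transitivity ((a * x i k + b * y i k) * (a * x j l + b * y j l)
      - a ^+ 2 * (x i k * x j l) - b ^+ 2 * (y i k * y j l)); first by ring.
  by rewrite mxy mx my; ring.
transitivity (s ^+ 2 * (x i k * x j l) + t ^+ 2 * (y i k * y j l)
  + s * t * (x i k * y j l + y i k * x j l)); first by ring.
by rewrite mx my cross; ring.
Qed.

Lemma rank1_neq0 (x : 'M[F]_(m, n)) : \rank x = 1%N -> x != 0.
Proof. by move=> rx; rewrite -mxrank_eq0 rx. Qed.

End RankOne.

(** * Conjugates of diagonal matrices *)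

Section Conjugation.
Variables (F : fieldType) (n : nat).

Lemma rank_conj (B A : 'M[F]_n) : B \in unitmx ->
  \rank (B *m A *m invmx B) = \rank A.
Proof.
move=> uB; rewrite mxrankMfree ?row_free_unit ?unitmx_inv //.
by rewrite eqmxMfull ?row_full_unit.
Qed.

Lemma conj_unitmxK (B A : 'M[F]_n) : B \in unitmx ->
  invmx B *m (B *m A *m invmx B) *m B = A.
Proof. by move=> uB; rewrite !mulmxA mulVmx // mul1mx mulmxKV. Qed.

Lemma rank1_diag (d : 'rV[F]_n) : \rank (diag_mx d) = 1%N ->
  exists i c, c != 0 /\ d = c *: delta_mx 0 i.
Proof.
move=> rd.
have [i di] : exists i, d 0 i != 0.
  apply/existsP; apply: contraTT (rank1_neq0 rd) => /existsPn d0.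
  apply/negPn/eqP; rewrite (_ : d = 0) ?raddf0 //.
  by apply/rowP => i; rewrite mxE; apply/eqP/negPn/d0.
exists i, (d 0 i); split=> //; apply/rowP => j; rewrite !mxE eqxx /=.
have [->|ij] := eqVneq j i; first by rewrite mulr1.
have := rank1_minors i j i j rd; rewrite !mxE !eqxx (negPf ij) !mulr1n mulr0n.
by rewrite !mulr0 => /eqP; rewrite mulf_eq0 (negPf di) => /eqP.
Qed.

Lemma scale_sandwich (B A D : 'M[F]_n) a :
  B *m (a *: A) *m D = a *: (B *m A *m D).
Proof. by rewrite -scalemxAr -scalemxAl. Qed.

(** Between the outer factors [U] and [V] each side is a product of three diagonal matrices, and
    these commute. *)
Lemma diag_sandwich_commute (U V : 'M[F]_n) m d e : V *m U = diag_mx m ->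
  (U *m diag_mx d *m V) *m (U *m diag_mx e *m V) =
  (U *m diag_mx e *m V) *m (U *m diag_mx d *m V).
Proof.
move=> VU; rewrite !mulmxA -![_ *m V *m U]mulmxA VU -!mulmxA; congr (U *m _).
rewrite !mulmxA !mulmx_diag; congr (diag_mx _ *m V).
by apply/rowP => i; rewrite !mxE; ring.
Qed.

Lemma conj_similar (B L A D : 'M[F]_n) : B \in unitmx -> L \in unitmx ->
  A *m L = L *m D ->
  B *m A *m invmx B = (B *m L) *m D *m invmx (B *m L).
Proof.
move=> uB uL AL; have uBL : B *m L \in unitmx by rewrite unitmx_mul uB.
apply: (can_inj (mulmxK uBL)); rewrite mulmxKV // mulmxA mulmxKV //.
by rewrite -!mulmxA AL.
Qed.

End Conjugation.

(** * Lower triangular 3 x 3 matrices *)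

Section LowerTriangular.
Variable F : fieldType.

(** The diagonal is encoded by its middle entry and the consecutive differences [al] and [be],
    because commutation depends on the diagonal only through these. *)
Definition lower_trig (a al be x y z : F) : 'M[F]_3 :=
  \matrix_(i, j) nth 0 (nth [::]
    [:: [:: a + al; 0; 0]; [:: x; a; 0]; [:: z; y; a - be]] i) j.

Lemma trig_lower_trig (A : 'M[F]_3) : is_trig_mx A ->
  A = lower_trig (A 1 1) (A 0 0 - A 1 1) (A 1 1 - A 2 2)
    (A 1 0) (A 2 1) (A 2 0).
Proof.
move=> /is_trig_mxP trigA; apply/matrixP => i j; rewrite mxE.
case: i => [[|[|[|//]]] i3]; case: j => [[|[|[|//]]] j3] /=;
  rewrite ?subKr ?[A 1 1 + _]addrC ?subrK;
  by [rewrite trigA | congr (A _ _); apply: val_inj].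
Qed.

(** The columns of [L] are eigenvectors. As [L] depends only on [p], [q] and [r], it diagonalizes
    both members of a pair sharing these coefficients. *)
Lemma lower_trig_diag (a al be p q r : F) :
  let L := lower_trig 1 0 0 p q (p * q + r) in
  lower_trig a al be (p * al) (q * be) (p * q * al + r * (al + be)) *m L =
  L *m diag_mx (\row_k [:: a + al; a; a - be]`_k).
Proof.
apply/matrixP => i j; rewrite mul_mx_diag !mxE !big_ord_recl big_ord0 !mxE /=.
by case: i => [[|[|[|//]]] i3]; case: j => [[|[|[|//]]] j3] /=; ring.
Qed.

Lemma lower_trig_unit (x y z : F) : lower_trig 1 0 0 x y z \in unitmx.
Proof.
rewrite unitmxE det_trig.
  by rewrite !big_ord_recl big_ord0 !mxE /= addr0 subr0 !mulr1 unitr1.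
by apply/is_trig_mxP => -[[|[|[|//]]] i3] [[|[|[|//]]] j3] //; rewrite !mxE.
Qed.

Lemma lower_trig_line (a al be x y z al' be' y' z' s : F) :
  lower_trig a (al + s * al') (be + s * be') x (y + s * y') (z + s * z') =
  lower_trig a al be x y z + s *: lower_trig 0 al' be' 0 y' z'.
Proof.
apply/matrixP => i j; rewrite !mxE.
by case: i => [[|[|[|//]]] i3]; case: j => [[|[|[|//]]] j3] /=; ring.
Qed.

(** These are the entries (1, 0), (2, 1) and (2, 0) of the commutator, from which the middle
    diagonal entries [a] and [b] cancel. *)
Lemma lower_trig_commute (a al be x y z b al' be' x' y' z' : F) :
  lower_trig a al be x y z *m lower_trig b al' be' x' y' z' =
  lower_trig b al' be' x' y' z' *m lower_trig a al be x y z ->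
  [/\ al * x' = al' * x, be * y' = be' * y &
      z * (al' + be') - z' * (al + be) = x * y' - x' * y].
Proof.
move=> /matrixP comm; have := (comm 1 0, comm 2 1, comm 2 0).
rewrite !mxE !big_ord_recl !big_ord0 !mxE /= => -[[e10 e21] e20]; split.
- apply/eqP; rewrite -subr_eq0; apply/eqP.
  by move/eqP: e10; rewrite eq_sym -subr_eq0 => /eqP <-; ring.
- apply/eqP; rewrite -subr_eq0; apply/eqP.
  by move/eqP: e21; rewrite eq_sym -subr_eq0 => /eqP <-; ring.
apply/eqP; rewrite -subr_eq0; apply/eqP.
by move/eqP: e20; rewrite -subr_eq0 => /eqP <-; ring.
Qed.

End LowerTriangular.

(** * Polynomials along a line *)

Lemma horner_ext0 (F : numDomainType) (p : {poly F}) :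
  (forall s, p.[s] = 0) -> p = 0.
Proof.
move=> p0; apply/eqP; apply/negPn/negP => pn0.
(* The integers below [size p] are distinct roots, one more than a nonzero [p] can have. *)
have := @max_poly_roots _ p [seq i%:R | i <- iota 0 (size p)] pn0.
rewrite size_map size_iota ltnn => H; apply/notF/H.
  by apply/allP => s _; rewrite rootE p0.
rewrite map_inj_uniq ?iota_uniq // => i j /eqP.
by rewrite eqr_nat => /eqP.
Qed.

Lemma meval_along (F : comNzRingType) n (f : {mpoly F[n]})
    (q : 'I_n -> {poly F}) :
  exists p : {poly F}, forall s, p.[s] = f.@[fun k => (q k).[s]].
Proof.
exists (\sum_(m <- msupp f) (f@_m)%:P * \prod_i q i ^+ m i) => s.
rewrite mevalE horner_sum; apply: eq_bigr => m _.
rewrite hornerM hornerC horner_prod; congr (_ * _).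
by apply: eq_bigr => i _; rewrite horner_exp.
Qed.

Lemma horner_line_minor (F : comNzRingType) (a a' b b' c c' d d' s : F) :
  ((a%:P + a'%:P * 'X) * (b%:P + b'%:P * 'X)
     - (c%:P + c'%:P * 'X) * (d%:P + d'%:P * 'X)).[s] =
  (a + s * a') * (b + s * b') - (c + s * c') * (d + s * d').
Proof. by rewrite !hornerE; ring. Qed.

(** * Pluecker vectors and passage to the limit along a line *)

Section Reductions.
Variable R : realType.
Local Notation C := R[i].
Implicit Types (u v : 'M[C]_3) (U W : {vspace 'M[C]_3}).
Implicit Types f : {mpoly C[(3 * 3) * (3 * 3)]}.

Lemma plueckerE u v i j : pluecker u v 0 (mxvec_index i j) =
  mxvec u 0 i * mxvec v 0 j - mxvec v 0 i * mxvec u 0 j.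
Proof. by rewrite /pluecker mxvecE !mxE !big_ord1 !mxE. Qed.

(** If all [u_i v_j - v_i u_j] vanish and [v_j] is a nonzero coordinate, then [u] is [u_j / v_j]
    times [v]. *)
Lemma free_pluecker u v : free [:: u; v] = (pluecker u v != 0).
Proof.
apply/idP/idP.
  rewrite free_cons seq1_free span_seq1 => /andP[uv v0].
  apply: contra uv => /eqP uv0.
  have [j vj] : exists j, mxvec v 0 j != 0.
    apply/existsP; apply: contraR v0 => /existsPn v0.
    rewrite -mxvec_eq0; apply/eqP/rowP => j; rewrite mxE.
    exact/eqP/negPn.
  apply/vlineP; exists (mxvec u 0 j / mxvec v 0 j).
  apply: (can_inj mxvecK); apply/rowP => i; rewrite linearZ mxE.
  have /eqP := plueckerE u v i j; rewrite uv0 mxE eq_sym subr_eq0 => /eqP e.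
  by apply: (mulIf vj); rewrite e mulrAC mulfVK // mulrC.
apply: contraR; rewrite free_cons seq1_free span_seq1 negb_and !negbK.
move=> /orP[/vlineP[k ->]|/eqP ->]; apply/eqP/rowP => k';
  case/mxvec_indexP: k' => i j; rewrite plueckerE.
  by rewrite [mxvec (k *: v)]linearZ !mxE /=; ring.
by rewrite [mxvec 0]linear0 !mxE mulr0 mul0r subrr.
Qed.

(* The guard excludes dependent pairs, whose zero Pluecker vector need not
   annihilate a polynomial of degree 0. *)
Definition vanishes_on_reduction f u v : Prop :=
  pluecker (projI u) (projI v) != 0 ->
  f.@[fun k => pluecker (projI u) (projI v) 0 k] = 0.

Lemma vanishes_on_reduction_curve f u v u' v' :
  (forall s, s != 0 -> vanishes_on_reduction f (u + s *: u') (v + s *: v')) ->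
  vanishes_on_reduction f u v.
Proof.
move=> curve /eqP/rowP nz.
pose pu := mxvec (projI u); pose pv := mxvec (projI v).
pose pu' := mxvec (projI u'); pose pv' := mxvec (projI v').
pose l (a b : 'rV[C]_(3 * 3)) i : {poly C} := (a 0 i)%:P + (b 0 i)%:P * 'X.
pose q k : {poly C} := mxvec (\matrix_(i, j)
  (l pu pu' i * l pv pv' j - l pv pv' i * l pu pu' j)) 0 k.
have qE k s : (q k).[s] =
    pluecker (projI (u + s *: u')) (projI (v + s *: v')) 0 k.
  have lineE w w' : mxvec (projI (w + s *: w')) =
      mxvec (projI w) + s *: mxvec (projI w').
    by rewrite ![_ + s *: _]addrC; exact: (linearP (mxvec \o @projI R)).
  case/mxvec_indexP: k => i j; rewrite plueckerE /q mxvecE mxE /l !lineE.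
  rewrite horner_line_minor ![fun_of_matrix (_ + _) _ _]mxE.
  by rewrite ![fun_of_matrix (_ *: _) _ _]mxE.
have [p pE] := meval_along f q.
have {nz}[k qk] : exists k, q k != 0.
  apply/existsP; apply: contra_notT nz => /existsPn q0 k.
  have /negPn/eqP qk := q0 k.
  by rewrite mxE -(horner0 0) -qk qE !scale0r !addr0.
(* The factor ['X] takes care of [s = 0], and [q k] of the finitely many [s] at which the projected
   pair may be dependent; elsewhere [p] vanishes by [curve]. *)
have : q k * p * 'X = 0.
  apply: horner_ext0 => s; rewrite !hornerE.
  have [->|s0] := eqVneq s 0; first by rewrite mulr0.
  have [->|qs] := eqVneq (q k).[s] 0; first by rewrite !mul0r.
  rewrite pE (_ : f.@[_] = 0) ?mulr0 ?mul0r //.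
  rewrite -[RHS](curve s s0); first by apply: meval_eq => i; rewrite qE.
  by apply: contraNneq qs => p0; rewrite qE p0 mxE.
move/eqP; rewrite !mulf_eq0 (negPf qk) polyX_eq0 orbF => /eqP p0.
rewrite -(horner0 0) -p0 pE; apply: meval_eq => i.
by rewrite qE !scale0r !addr0.
Qed.

(** * Reductions are abelian *)

Lemma simply_3_secant_basis W : \dim W = 3%N -> simply_3_secant W ->
  exists x : 'I_3 -> 'M[C]_3, (forall i, \rank (x i) = 1%N) /\
    basis_of W [tuple x i | i < 3].
Proof.
move=> dW [cW _].
have [h /bij_inj hI] : exists h : `I_3 -> [set L | X2 R L /\ (L <= W)%VS],
    bijective h by apply/card_bijP; rewrite card_eq_sym.
pose L (i : 'I_3) : {vspace 'M[C]_3} :=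
  val (h (SigSub (mem_set (ltn_ord i : `I_3 i)))).
have LI : injective L by move=> i j /val_inj/hI[] /val_inj.
have [x xP] : exists x : 'I_3 -> 'M[C]_3, forall i,
    [/\ \rank (x i) = 1%N, x i \in W & L i = <[x i]>%VS].
  suff /boolp.choice[x xP] : forall i, exists y : 'M[C]_3,
      [/\ \rank y = 1%N, y \in W & L i = <[y]>%VS] by exists x.
  move=> i; rewrite /L; case: (h _) => /= U.
  by move=> /set_mem[[y ry <-] yW]; exists y; rewrite memvE.
have x_notin i j : i != j -> x i \notin <[x j]>%VS.
  apply: contraNN => xij; apply/eqP/LI.
  have [ri _ ->] := xP i; have [rj _ ->] := xP j.
  by apply/eqP; rewrite eqEdim -memvE xij !dim_vline !rank1_neq0.
have [r0 W0 _] := xP 0; have [r1 W1 _] := xP 1; have [r2 W2 _] := xP 2.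
exists x; split; first by move=> i; have [] := xP i.
have -> : tval [tuple x i | i < 3] = [:: x 0; x 1; x 2].
  rewrite /= !enum_ordSl enum_ord0 /=.
  by congr [:: x _; x _; x _]; apply/val_inj.
rewrite basisEfree dW leqnn andbT; apply/andP; split; last first.
  by apply/span_subvP => y; rewrite !inE => /or3P[] /eqP ->.
rewrite free_cons free_cons seq1_free span_seq1 x_notin // rank1_neq0 ?andbT //.
(* Suppose [x 0] is on the line through [x 1] and [x 2]. Both coefficients are nonzero since the
   three points are distinct, so [rank1_pencil] applies. *)
apply/negP; rewrite span_cons span_seq1 => /memv_addP[_ /vlineP[a ->]].
move=> [_ /vlineP[b ->]] x0E.
have a0 : a != 0.
  apply: contraTneq (x_notin 0 2 isT) => a0.
  by rewrite x0E a0 scale0r add0r negbK memvZ ?memv_line.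
have b0 : b != 0.
  apply: contraTneq (x_notin 0 1 isT) => b0.
  by rewrite x0E b0 scale0r addr0 negbK memvZ ?memv_line.
(* Distinct integers give distinct points of this line, all in X2; four of them contradict the count
   of three. *)
pose g n := <[x 1 + n%:R *: x 2]>%VS.
have indep (s t : C) : s *: x 1 + t *: x 2 = 0 -> s = 0.
  move=> st; apply/eqP; apply: contraNT (x_notin 1 2 isT) => s0.
  apply/vlineP; exists (- (t / s)); apply: (scalerI s0).
  rewrite scaleNr scalerN scalerA mulrC divfK //.
  by apply/eqP; rewrite -addr_eq0 st.
have gnz n : x 1 + n%:R *: x 2 != 0.
  apply: contra_neq (oner_neq0 C) => e; apply: (indep 1 n%:R).
  by rewrite scale1r.
have gS n : [set L | X2 R L /\ (L <= W)%VS] (g n).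
  split; last by rewrite -memvE memvD // memvZ.
  exists (x 1 + n%:R *: x 2) => //=.
  by rewrite -[x 1]scale1r; apply: (rank1_pencil r1 r2 _ a0 b0);
    rewrite ?scale1r // -x0E.
have gI : {in `I_4 &, injective g}.
  move=> m n _ _ gmn.
  have /vlineP[k e] : x 1 + m%:R *: x 2 \in g n by rewrite -gmn memv_line.
  have k1 : 1 - k = 0.
    apply: (indep _ (m%:R - k * n%:R)).
    move/eqP: e; rewrite -subr_eq0 => /eqP e.
    by rewrite -[RHS]e !scalerBl scale1r scalerDr scalerA opprD addrACA.
  have {}k1 : k = 1 by apply/eqP; rewrite eq_sym -subr_eq0 k1.
  move: e; rewrite k1 scale1r => /addrI /eqP.
  rewrite -subr_eq0 -scalerBl scaler_eq0 (negPf (rank1_neq0 r2)) orbF subr_eq0.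
  by rewrite eqr_nat => /eqP.
suff : (`I_4 #<= `I_3)%card by rewrite card_le_II.
rewrite -(card_le_eqr cW) -(card_le_eql (inj_card_eq gI)).
by apply: subset_card_le => _ [n _ <-].
Qed.

(** With the rank one factors of a basis gathered into [U] and [V], every element of [W] is
    [U *m diag_mx d *m V]. The identity being one of them makes [V *m U] diagonal. *)
Lemma secant_commute W : \dim W = 3%N -> 1%:M \in W -> simply_3_secant W ->
  forall X Y, X \in W -> Y \in W -> X *m Y = Y *m X.
Proof.
move=> dW W1 /(simply_3_secant_basis dW)[x [rx xB]].
have [c [r xE]] : exists c : 'I_3 -> 'cV[C]_3, exists r : 'I_3 -> 'rV[C]_3,
    forall i, x i = c i *m r i.
  have : forall i, exists cr : 'cV[C]_3 * 'rV[C]_3, x i = cr.1 *m cr.2.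
    move=> i; move: (col_base (x i)) (row_base (x i)) (mulmx_base (x i)).
    by rewrite rx => ci ri <-; exists (ci, ri).
  by move=> /boolp.choice[cr crE]; exists (fst \o cr), (snd \o cr).
pose U := \matrix_(i, j) c j i 0; pose V := \matrix_(i, j) r i 0 j.
have WE X : X \in W -> exists d, X = U *m diag_mx d *m V.
  move=> /(coord_basis xB) XE.
  exists (\row_i coord [tuple x i | i < 3] i X).
  rewrite {1}XE; apply/matrixP => i j; rewrite summxE mxE.
  apply: eq_bigr => k _.
  rewrite (nth_map ord0) ?size_enum_ord // nth_ord_enum xE.
  by rewrite mul_mx_diag !mxE big_ord1; ring.
have [a aE] := WE _ W1.
(* V is inverse to U diag(a) on both sides, so V U is diagonal. *)
have VU : V *m U *m diag_mx a = 1%:M by rewrite -mulmxA; apply/mulmx1C.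
have VUij i j : (V *m U) i j * a 0 j = (i == j)%:R.
  by have /matrixP/(_ i j) := VU; rewrite mul_mx_diag !mxE.
have VUdiag : V *m U = diag_mx (\row_i (V *m U) i i).
  apply/matrixP => i j; rewrite [RHS]mxE [X in X *+ _]mxE.
  have [->|ij] := eqVneq i j; first by rewrite mulr1n.
  have aj : a 0 j != 0.
    apply: contra_eq_neq (VUij j j) => ->.
    by rewrite mulr0 eqxx eq_sym oner_eq0.
  by apply: (mulIf aj); rewrite VUij (negPf ij) mulr0n mul0r.
by move=> X Y /WE[d ->] /WE[e ->]; apply: diag_sandwich_commute VUdiag.
Qed.

(** * Projection from [I] *)

Lemma mxtrace_third (a : C) : \tr ((3%:R^-1 * a)%:M : 'M[C]_3) = a.
Proof. by rewrite mxtrace_scalar -[LHS]mulr_natl mulVKf // pnatr_eq0. Qed.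

Lemma trace_projI u : \tr (projI u) = 0.
Proof. by rewrite /projI linearB /= mxtrace_third subrr. Qed.

Lemma projI_sl3 u : u \in sl3 R -> projI u = u.
Proof.
by rewrite mem_sl3 => /eqP tr0; rewrite /projI tr0 mulr0 raddf0 subr0.
Qed.

Lemma projI_commute u v : u *m v = v *m u ->
  projI u *m projI v = projI v *m projI u.
Proof.
move=> uv; apply: comm_mxB; last exact: comm_mx_scalar.
by apply/comm_mx_sym/comm_mxB => //; apply: comm_mx_scalar.
Qed.

(** The kernel of [projI] is the line of scalar matrices, which lies in [W]. *)
Lemma dim_projI W : 1%:M \in W -> (\dim (linfun (@projI R) @: W)).+1 = \dim W.
Proof.
move=> W1; rewrite -(limg_ker_dim (linfun (@projI R)) W).
suff -> : (W :&: lker (linfun (@projI R)))%VS = <[1%:M]>%VS.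
  by rewrite dim_vline -mxrank_eq0 mxrank1.
apply/vspaceP => X; rewrite memv_cap memv_ker lfunE /=; apply/andP/vlineP.
  move=> [_]; rewrite /projI subr_eq0 => /eqP XE.
  by exists (3%:R^-1 * \tr X); rewrite scalemx1.
move=> [k ->]; split; first exact: memvZ.
rewrite scalemx1 /projI mxtrace_scalar -[k *+ 3]mulr_natl.
by rewrite mulKf ?subrr ?pnatr_eq0.
Qed.

Lemma projI_image_G2 W : \dim W = 3%N -> 1%:M \in W ->
  G2sl3 R (linfun (@projI R) @: W)%VS.
Proof.
move=> dW /dim_projI; rewrite dW => -[dP]; split=> //.
by apply/subvP => _ /memv_imgP[X _ ->]; rewrite lfunE mem_sl3 /= trace_projI.
Qed.

Lemma secant_reductions_abelian : secant_reductions R `<=` abelian_planes R.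
Proof.
move=> _ [W [dW W1 sW] <-]; split; first exact: projI_image_G2.
move=> _ _ /memv_imgP[X XW ->] /memv_imgP[Y YW ->]; rewrite !lfunE /= /lie.
by rewrite (projI_commute (secant_commute dW W1 sW XW YW)) subrr.
Qed.

(** * Equations of the abelian planes *)

Lemma basis_dim2 U : \dim U = 2%N -> exists u v, basis_of U [:: u; v].
Proof.
move=> dU; have := vbasisP U; have := size_tuple (vbasis U); rewrite {2}dU.
by case: (tval _) => [|u [|v []]] // _ ?; exists u, v.
Qed.

(* The entries of the bracket of a basis (u, v) are the linear forms
   sum_k (u_ik v_kj - v_ik u_kj) in the Pluecker coordinates. *)
Lemma abelian_planes_closed : zariski_closed (abelian_planes R).
Proof.
pose br i j : {mpoly C[(3 * 3) * (3 * 3)]} :=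
  \sum_k 'X_(mxvec_index (mxvec_index i k) (mxvec_index k j)).
have brE i j u v : (br i j).@[fun k => pluecker u v 0 k] = lie u v i j.
  rewrite raddf_sum /= !mxE -sumrB; apply: eq_bigr => k _.
  by rewrite mevalXU plueckerE !mxvecE.
exists [set p | exists i j, p = br i j]; split.
  move=> _ [i [j ->]]; exists 1%N; apply: rpred_sum => k _.
  by rewrite dhomogX; apply/eqP/mdeg1.
apply/seteqP; split=> [P [GP cP]|P [GP vP]]; split=> //.
  move=> _ [i [j ->]] u v uvB; rewrite brE cP ?mxE //;
    by apply: (basis_mem uvB); rewrite !inE eqxx ?orbT.
have [u [v uvB]] := basis_dim2 GP.2.
have uv0 : lie u v = 0.
  by apply/matrixP => i j; rewrite -brE mxE; apply: vP uvB; exists i, j.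
have coords X : X \in P -> exists a b, X = a *: u + b *: v.
  rewrite -(span_basis uvB) span_cons span_seq1.
  by move=> /memv_addP[_ /vlineP[a ->] [_ /vlineP[b ->] ->]]; exists a, b.
move=> _ _ /coords[a [b ->]] /coords[c [d ->]].
(* The bracket is bilinear and alternating. *)
transitivity ((a * d - b * c) *: lie u v); last by rewrite uv0 scaler0.
rewrite /lie !mulmxDl !mulmxDr -!scalemxAl -!scalemxAr !scalerA.
by apply/matrixP => i j; rewrite ![in LHS]mxE ![in RHS]mxE; ring.
Qed.

(** * Planes of simultaneously diagonalizable matrices are simply 3-secant *)

Lemma X2_tangent_factor (x y : 'M[C]_3) : \rank x = 1%N -> X2_tangent x y ->
  exists i k (c : 'cV[C]_3) (r : 'rV[C]_3), y = col k x *m r + c *m row i x.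
Proof.
move=> rx xy.
have [[i k] /= xik] : exists ik, x ik.1 ik.2 != 0.
  apply/existsP; apply: contraTT (rank1_neq0 rx) => /existsPn x0.
  by apply/negPn/eqP/matrixP => i k; rewrite mxE; apply/eqP/negPn/(x0 (i, k)).
(* The witnesses come from differentiating [x = (x i k)^-1 *: (col k x *m row i x)] in the direction
   [y]. *)
exists i, k, ((x i k)^-1 *: col k y).
exists ((x i k)^-1 *: (row i y - (y i k / x i k) *: row i x)).
apply/matrixP => j l; rewrite !mxE !big_ord1 !mxE.
apply: (mulfI (mulf_neq0 xik xik)).
have /eqP := xy i j k l; rewrite subr_eq0 => /eqP tan.
transitivity (x i k * (x i k * y j l + y i k * x j l)
    - y i k * (x i k * x j l)); first by ring.
by rewrite tan (rank1_minors i j k l rx); field.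
Qed.

(** A diagonal matrix of rank one has a single nonzero entry, so the points of X2 in [W] are the
    lines of the three idempotents [E i]. *)
Lemma diag_secant (B : 'M[C]_3) W : B \in unitmx ->
  (forall X, X \in W <-> exists d, X = B *m diag_mx d *m invmx B) ->
  simply_3_secant W.
Proof.
move=> uB WE.
pose E (i : 'I_3) := B *m diag_mx (delta_mx 0 i) *m invmx B.
have diagE i : diag_mx (delta_mx 0 i : 'rV[C]_3) = delta_mx i i.
  apply/matrixP => j k; rewrite !mxE eqxx /=.
  have [->|jk] := eqVneq j k; first by rewrite andbb mulr1n.
  by rewrite mulr0n; case: eqVneq => //= <-; rewrite eq_sym (negPf jk).
have rE i : \rank (E i) = 1%N by rewrite rank_conj // diagE mxrank_delta.
have EW i : E i \in W by apply/WE; exists (delta_mx 0 i).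
have rank1W x : \rank x = 1%N -> x \in W -> exists i c, c != 0 /\ x = c *: E i.
  move=> + /WE[d xE]; rewrite xE rank_conj // => /rank1_diag[i [c [c0 ->]]].
  by exists i, c; rewrite linearZ /= scale_sandwich.
split.
  have -> : [set L | X2 R L /\ (L <= W)%VS] =
      [set <[E i]>%VS | i in [set: 'I_3]].
    apply/seteqP; split=> [_ [[x rx <-] xW]|_ [i _ <-]].
      rewrite -memvE in xW; have [i [c [c0 ->]]] := rank1W x rx xW.
      exists i => //; apply/eqP; rewrite eqEdim -memvE !dim_vline.
      rewrite scaler_eq0 (negPf c0) rank1_neq0 // andbT.
      by apply/vlineP; exists c^-1; rewrite scalerA mulVf // scale1r.
    by split; [exists (E i)|rewrite -memvE].
  apply: card_eq_trans (inj_card_eq _) _; last by rewrite card_eq_sym card_II.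
  move=> i j _ _ Eij.
  have /vlineP[k /(congr1 (fun X => (invmx B *m X *m B) i i))] :
    E i \in <[E j]>%VS by rewrite -Eij memv_line.
  rewrite scale_sandwich !conj_unitmxK // !mxE !eqxx.
  have [//|_] := eqVneq i j; rewrite mulr0n mulr0 => /eqP.
  by rewrite oner_eq0.
move=> x rx xW y /WE[e yE] /(X2_tangent_factor rx)[k [l [c [r yE']]]].
have [i [a [a0 xE]]] := rank1W x rx xW.
(* Conjugating back, the column and row of [x] in the tangent vector are supported at [i], so its
   other diagonal entries vanish. *)
suff e0 j : j != i -> e 0 j = 0.
  apply/vlineP; exists (e 0 i / a); rewrite xE scalerA divfK // yE /E.
  rewrite -scale_sandwich -[_ *: diag_mx _]linearZ.
  congr (_ *m diag_mx _ *m _).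
  apply/rowP => j; rewrite !mxE eqxx /=; have [->|ij] := eqVneq j i.
    by rewrite mulr1.
  by rewrite mulr0 e0.
move=> ji; have /matrixP/(_ j j) := conj_unitmxK (diag_mx e) uB.
rewrite -yE yE' mulmxDr mulmxDl.
rewrite [RHS]mxE eqxx mulr1n => <-.
have colx0 : (invmx B *m col l x) j 0 = 0.
  rewrite colE mulmxA -colE mxE xE -scalemxAr /E diagE !mulmxA mulVmx // mul1mx.
  by rewrite mxE mxE big1 ?mulr0 // => m _; rewrite mxE (negPf ji) mul0r.
have rowx0 : (row k x *m B) 0 j = 0.
  rewrite rowE -mulmxA -rowE mxE xE -scalemxAl /E diagE mulmxKV // mxE mxE.
  by rewrite big1 ?mulr0 // => m _; rewrite mxE (negPf ji) andbF mulr0.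
rewrite -[invmx B *m (c *m _) *m B]mulmxA -[c *m _ *m B]mulmxA.
rewrite !mulmxA -[_ *m row k x *m B]mulmxA -[_ *m r *m B]mulmxA.
rewrite mxE [X in X + _]mxE [X in _ + X]mxE !big_ord1.
by rewrite colx0 rowx0 mul0r mulr0 addr0.
Qed.

(** The conjugated diagonal matrices form a simply 3-secant plane through [I]; the projected pair,
    once free, is a basis of the resulting reduction. *)
Lemma pluecker_vanish_diag f (B : 'M[C]_3) d e : B \in unitmx ->
  (forall U, secant_reductions R U -> vanishes_at f U) ->
  vanishes_on_reduction f (B *m diag_mx d *m invmx B)
    (B *m diag_mx e *m invmx B).
Proof.
move=> uB fS; rewrite /vanishes_on_reduction -free_pluecker => uv_free.
pose phi := linfun (mulmxr (invmx B) \o (mulmx B \o @diag_mx C 3)).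
have phiE c : phi c = B *m diag_mx c *m invmx B by rewrite lfunE.
pose W := limg phi.
have WE X : X \in W <-> exists c, X = B *m diag_mx c *m invmx B.
  split=> [/memv_imgP[c _ ->]|[c ->]]; first by exists c.
  by rewrite -phiE memv_img ?memvf.
have W1 : 1%:M \in W.
  apply/WE; exists (const_mx 1).
  by rewrite diag_const_mx mulmx1 mulmxV.
have dW : \dim W = 3%N.
  rewrite limg_dim_eq ?dimvf //; apply/eqP; rewrite -subv0; apply/subvP => c.
  rewrite memv_cap memvf memv_ker phiE memv0 /= => /eqP c0.
  have := conj_unitmxK (diag_mx c) uB; rewrite c0 mulmx0 mul0mx => dc0.
  by apply/eqP/rowP => i; have /matrixP/(_ i i) := dc0; rewrite !mxE eqxx.
have projIW c :
    projI (B *m diag_mx c *m invmx B) \in (linfun (@projI R) @: W)%VS.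
  have : B *m diag_mx c *m invmx B \in W by apply/WE; exists c.
  by move=> /(memv_img (linfun (@projI R))); rewrite lfunE.
apply: (fS (linfun (@projI R) @: W)%VS).
  by exists W => //; split=> //; apply: diag_secant uB WE.
rewrite basisEfree uv_free (projI_image_G2 dW W1).2 andbT.
by apply/span_subvP => X; rewrite !inE => /orP[] /eqP ->.
Qed.

(** * From commuting pairs to reductions *)

Definition row2 (a b : C) : 'rV[C]_2 := \row_k [:: a; b]`_k.

Lemma pluecker_vanish_commuting f u v :
  (forall U, secant_reductions R U -> vanishes_at f U) ->
  u *m v = v *m u -> vanishes_on_reduction f u v.
Proof.
move=> fS uv; have [P /unitarymx_unit uP /andP[]] := cotrigonalization2 uv.
rewrite /similar_to /= !conjumx // => uT vT.
set S := P *m u *m _ in uT; set T := P *m v *m _ in vT.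
have uB : invmx P \in unitmx by rewrite unitmx_inv.
have conjK w : w = invmx P *m (P *m w *m invmx P) *m invmx (invmx P).
  by rewrite invmxK conj_unitmxK.
rewrite (conjK u) (conjK v) -/S -/T; set B := invmx P in uB *.
have : S *m T = T *m S.
  by rewrite /S /T !mulmxA !mulmxKV // -!mulmxA [u *m _]mulmxA uv !mulmxA.
clearbody S T B; clear -fS uT vT uB.
rewrite (trig_lower_trig uT) (trig_lower_trig vT).
move: (S 1 1) (S 0 0 - _) (S 1 1 - S 2 2) (S 1 0) (S 2 1) (S 2 0).
move: (T 1 1) (T 0 0 - _) (T 1 1 - T 2 2) (T 1 0) (T 2 1) (T 2 0).
move=> b b1 b2 b21 b32 b31 a a1 a2 a21 a32 a31.
move=> /lower_trig_commute[e10 e21 e20].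
(* The coordinate [k] of the plane vectors selects the member of the pair; the middle entry [c]
   stays fixed under the deformations. *)
pose M (c : C) k (al be x y z : 'rV[C]_2) :=
  B *m lower_trig c (al 0 k) (be 0 k) (x 0 k) (y 0 k) (z 0 k) *m invmx B.
pose G al be x y z :=
  vanishes_on_reduction f (M a 0 al be x y z) (M b 1 al be x y z).
suff : G (row2 a1 b1) (row2 a2 b2) (row2 a21 b21) (row2 a32 b32) (row2 a31 b31).
  by rewrite /G /M !mxE.
apply: commuting_triangular_ind.
- move=> al be p q r.
  pose L := lower_trig 1 0 0 p q (p * q + r).
  have uL : L \in unitmx := lower_trig_unit _ _ _.
  have uBL : B *m L \in unitmx by rewrite unitmx_mul uB.
  have ME c k :
      M c k al be (p *: al) (q *: be) (p * q *: al + r *: (al + be)) =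
      (B *m L) *m diag_mx (\row_i [:: c + al 0 k; c; c - be 0 k]`_i)
        *m invmx (B *m L).
    by apply: conj_similar => //; rewrite -lower_trig_diag !mxE.
  by rewrite /G !ME; apply: pluecker_vanish_diag.
- move=> al be x y z al' be' y' z' curve.
  pose M' k := B *m lower_trig 0 (al' 0 k) (be' 0 k) 0 (y' 0 k) (z' 0 k)
    *m invmx B.
  have ME c k s :
      M c k (al + s *: al') (be + s *: be') x (y + s *: y') (z + s *: z') =
      M c k al be x y z + s *: M' k.
    rewrite /M /M' -scale_sandwich -mulmxDl -mulmxDr -lower_trig_line.
    by rewrite !mxE.
  apply: (vanishes_on_reduction_curve (u' := M' 0) (v' := M' 1)) => s s0.
  by have := curve s s0; rewrite /G !ME.
- by rewrite /det2 !mxE /= e10 subrr.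
- by rewrite /det2 !mxE /= e21 subrr.
by rewrite /det2 !mxE /=.
Qed.

End Reductions.

Theorem proposition4p1 (R : realType) : Y2 R = abelian_planes R.
Proof.
apply/seteqP; split.
  exact: smallest_sub (@abelian_planes_closed R) (@secant_reductions_abelian R).
move=> P [GP cP] Z [[F [_ ->]] FS]; split=> // f Ff u v uvB.
have uP : u \in P by apply: (basis_mem uvB); rewrite !inE eqxx.
have vP : v \in P by apply: (basis_mem uvB); rewrite !inE eqxx orbT.
have uv : u *m v = v *m u by apply/eqP; rewrite -subr_eq0; apply/eqP/cP.
have fS U : secant_reductions R U -> vanishes_at f U by move=> /FS[_]; apply.
have := pluecker_vanish_commuting fS uv.
(* The pair lies in [sl3], where [projI] is the identity. *)
rewrite /vanishes_on_reduction !projI_sl3 ?(subvP GP.1) //; apply.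
by rewrite -free_pluecker (basis_free uvB).
Qed.
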